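(* Let $A,B\in\mathcal{S}_n$, $X\in\mathcal{M}_n$, $r\ge0$, $\mu\in[0,1]$, $p\in(0,1)$, and let $|||\cdot|||$ be any unitarily invariant norm on $\mathcal{M}_n$. Define $f(t)=|||\,|A^{t}XB^{1-t}|^r\,|||\;|||\,|A^{1-t}XB^{t}|^r\,|||$ for $t\in[0,1]$. Then \begin{align*} |||\,|AX|^r\,|||\;|||\,|XB|^r\,|||-|||\,|A^{\mu}XB^{1-\mu}|^r\,|||\;|||\,|A^{1-\mu}XB^{\mu}|^r\,||| \ge \frac1p\left(f\Big(\frac{1-p}{2}\Big)-f\Big(\frac{1-p}{2}+p\mu\Big)\right)\ge 0. \end{align*}
   Context: $\mathcal{M}_n$ is the algebra of $n\times n$ complex matrices, and $\mathcal{S}_n\subset\mathcal{M}_n$ is the set of positive semidefinite matrices. For $T\in\mathcal{M}_n$, $|T|=(T^*T)^{1/2}$. Nonnegative real powers of positive semidefinite matrices are taken by functional calculus, with the zeroth power equal to the identity matrix. A norm $|||\cdot|||$ on $\mathcal{M}_n$ is unitarily invariant if $|||UTV|||=|||T|||$ for all $T\in\mathcal{M}_n$ and all unitary $U,V\in\mathcal{M}_n$. *)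

(* Defs.v *)
From mathcomp Require Import all_boot all_order all_algebra.
From mathcomp Require Import sesquilinear spectral complex.
From mathcomp Require Import reals exp.

Set Implicit Arguments.
Unset Strict Implicit.
Unset Printing Implicit Defensive.

Import Order.TTheory GRing.Theory Num.Theory.
Local Open Scope ring_scope.
Local Open Scope complex_scope.
Local Open Scope sesquilinear_scope.

(* In [R[i]] the relation [0 <= z] says that z is real and nonnegative. *)
Definition psdmx (R : realType) (n : nat) (A : 'M[R[i]]_n) : Prop :=
  A \is hermsymmx /\ forall v : 'cV[R[i]]_n, 0 <= (v ^t* *m A *m v) 0 0.

(* Functional calculus f(A) of a Hermitian matrix A, for f : R -> R: apply f to
   the eigenvalues in a unitary diagonalization of A. The spectrum of A is real,
   so [complex.Re] loses nothing, and f(A) does not depend on which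
   diagonalization [spectralmx] and [spectral_diag] select. Junk value when A is
   not Hermitian. *)
Definition mxcalc (R : realType) (n : nat) (f : R -> R) (A : 'M[R[i]]_n) :
    'M[R[i]]_n :=
  invmx (spectralmx A)
    *m diag_mx (map_mx (fun z : R[i] => (f (complex.Re z))%:C) (spectral_diag A))
    *m spectralmx A.

(* [powR 0 0 = 1] and [powR 0 t = 0] for t > 0; hence the zeroth power is the
   identity, also for singular A. *)
Definition mxpowR (R : realType) (n : nat) (A : 'M[R[i]]_n) (t : R) :
    'M[R[i]]_n :=
  mxcalc (fun x => powR x t) A.

Definition absmx (R : realType) (n : nat) (T : 'M[R[i]]_n) : 'M[R[i]]_n :=
  mxpowR (T ^t* *m T) (1 / 2).

(* [`|a|] has type [R[i]] and is real; [complex.Re] brings it back to R. *)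
Record mxnorm (R : realType) (n : nat) (N : 'M[R[i]]_n -> R) : Prop := MxNorm {
  mxnorm_ge0 : forall T, 0 <= N T;
  mxnorm_eq0 : forall T, N T = 0 -> T = 0;
  mxnormZ : forall (a : R[i]) T, N (a *: T) = complex.Re `|a| * N T;
  mxnormD : forall S T, N (S + T) <= N S + N T
}.

Definition unitarily_invariant (R : realType) (n : nat)
    (N : 'M[R[i]]_n -> R) : Prop :=
  forall T U V : 'M[R[i]]_n, U \is unitarymx -> V \is unitarymx ->
    N (U *m T *m V) = N T.

(* Main.v *)
Require Import Defs.
From mathcomp Require Import all_boot all_order all_fingroup all_algebra.
From mathcomp Require Import sesquilinear spectral complex.
From mathcomp Require Import reals exp.
From mathcomp Require Import ring lra.

Set Implicit Arguments.
Unset Strict Implicit.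
Unset Printing Implicit Defensive.

Import Order.TTheory GRing.Theory Num.Theory.
Local Open Scope ring_scope.
Local Open Scope complex_scope.
Local Open Scope sesquilinear_scope.

(** Put F(t) = ||| |A^t X B^(1-t)|^r |||, so that f(t) = F(t) F(1-t). Then
    f(1 - t) = f(t), and f(0) = ||| |AX|^r ||| ||| |XB|^r ||| because the zeroth
    power is the identity. Once f is known to be convex on [0,1], both
    inequalities compare slopes of chords of a convex function symmetric about
    1/2 ([symmetric_convex_slopes]).

    Convexity needs no continuity of f in t. A function that is bounded on
    [0,1] and midpoint convex there is convex: subtract a chord; if the result
    is bounded by M, then midpoint convexity towards the nearer endpoint, where
    it vanishes, bounds it by M/2, hence by M/2^m for all m
    ([convex_of_midpoint]). So the discontinuity of A^t at t = 0 for singular A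
    does no harm.

    Midpoint convexity of f follows from F((s+t)/2)^2 <= F(s) F(t). For s <= t,
    with G = A^((t-s)/2), D = B^((t-s)/2) and Y = A^s X B^(1-t), this is the
    Cauchy-Schwarz inequality ([norm_abs_pow_cauchy])
      ||| |G Y D|^r |||^2 <= ||| |G^2 Y|^r ||| ||| |Y D^2|^r |||
    for Hermitian G and D. Its core is that for every k the product of the k
    largest eigenvalues satisfies
      (prod_k T^* T)^2 <= (prod_k K^* K) (prod_k L^* L),
    where T = G Y D, K = G^2 Y, L = Y D^2 ([log_majorization]). Indeed prod_k
    of T^* T is the determinant of its compression to the span of the top k
    eigenvectors. Since T^* T = D (K^* Y D), moving the first factor D to the
    end turns this determinant, unless it vanishes, into that of a compression
    of (K^* Y D) D = K^* L, and the determinant of a compression of K or L is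
    controlled by interlacing ([det_compress], [eig_le]).

    Log majorization passes to the powers r/2 and then yields weak majorization
    ([weak_log_major]). The functional x |-> ||| diag x ||| is convex,
    permutation invariant and monotone on nonnegative vectors, hence respects
    weak majorization ([weak_major_gauge]). What is left is Cauchy-Schwarz for
    this functional ([norm_rdiag_cauchy]), which is the weighted
    arithmetic-geometric mean inequality with an optimal weight. *)

(** * Diagonalization and functional calculus *)

Section Spectral.
Variable R : realType.
Implicit Types (m n k : nat).

Definition rdiag n (d : 'I_n -> R) : 'M[R[i]]_n := diag_mx (\row_i (d i)%:C).

Definition eigdec n (H U : 'M[R[i]]_n) (d : 'I_n -> R) :=
  U \is unitarymx /\ H = U^t* *m rdiag d *m U.

Lemma adj_mul m n k (A : 'M[R[i]]_(m, n)) (B : 'M[R[i]]_(n, k)) :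
  (A *m B)^t* = B^t* *m A^t*.
Proof. by rewrite trmx_mul map_mxM. Qed.

Lemma conjC_real (x : R) : (x%:C)^*%R = x%:C :> R[i].
Proof. by apply/CrealP; rewrite complex_real. Qed.

Lemma rdiag_adj n (d : 'I_n -> R) : (rdiag d)^t* = rdiag d.
Proof.
apply/matrixP => i j; rewrite !mxE eq_sym; case: eqP => [->|_].
  by rewrite !mulr1n conjC_real.
by rewrite !mulr0n conjC0.
Qed.

Lemma adj_unitary n (U : 'M[R[i]]_n) : U \is unitarymx -> U^t* *m U = 1%:M.
Proof. by move=> hU; rewrite -invmx_unitary // mulVmx ?unitarymx_unit. Qed.

Lemma herm_adjP n (H : 'M[R[i]]_n) : H \is hermsymmx <-> H^t* = H.
Proof.
split=> [/is_hermitianmxP|h]; first by rewrite expr0 scale1r.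
by apply/is_hermitianmxP; rewrite expr0 scale1r.
Qed.

Lemma eigdec_herm n (H U : 'M[R[i]]_n) d : eigdec H U d -> H^t* = H.
Proof. by case=> hU ->; rewrite !adj_mul rdiag_adj trmxCK !mulmxA. Qed.

Lemma spectral_eq n (H : 'M[R[i]]_n) : H \is normalmx ->
  H = (spectralmx H)^t* *m diag_mx (spectral_diag H) *m spectralmx H.
Proof.
move=> /orthomx_spectralP e; rewrite {1}e.
by rewrite (invmx_unitary (spectral_unitarymx H)).
Qed.

(** The calculus does not depend on the diagonalization: the unitary matrix W
    relating two diagonalizations satisfies sp_i w_ij = w_ij d_j, so either
    w_ij = 0 or the eigenvalues agree, and f may be applied to both. *)
Lemma mxcalcE n (f : R -> R) (H U : 'M[R[i]]_n) d :
  eigdec H U d -> mxcalc f H = U^t* *m rdiag (f \o d) *m U.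
Proof.
move=> hd; have [hU eH] := hd.
have hn : H \is normalmx.
  exact/hermitian_normalmx/herm_adjP/(eigdec_herm hd).
have hP := spectral_unitarymx H.
rewrite /mxcalc; set P := spectralmx H in hP *; set sp := spectral_diag H.
have eH2 : H = P^t* *m diag_mx sp *m P := spectral_eq hn.
rewrite (invmx_unitary hP).
have key W : diag_mx sp *m W = W *m rdiag d ->
    diag_mx (map_mx (fun z : R[i] => (f (complex.Re z))%:C) sp) *m W
      = W *m rdiag (f \o d).
  move=> eW; apply/matrixP => i j; move/matrixP/(_ i j): eW.
  rewrite !mul_diag_mx !mul_mx_diag !mxE.
  have [-> | w0] := eqVneq (W i j) 0; first by rewrite !mulr0 !mul0r.
  by rewrite [RHS]mulrC => /(mulIf w0) ->; rewrite mulrC.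
have /key : diag_mx sp *m (P *m U^t*) = P *m U^t* *m rdiag d.
  have : P *m H *m U^t* = P *m H *m U^t* by [].
  rewrite {1}eH2 eH !mulmxA (unitarymxP hP) mul1mx => ->.
  by rewrite -[LHS]mulmxA (unitarymxP hU) mulmx1.
rewrite mulmxA => /(congr1 (fun M => P^t* *m M *m U)).
rewrite !mulmxA (adj_unitary hP) mul1mx => <-.
by rewrite -!mulmxA (adj_unitary hU) mulmx1.
Qed.

Lemma eigdec_ex n (H : 'M[R[i]]_n) : H^t* = H -> exists U d, eigdec H U d.
Proof.
move=> /herm_adjP hH.
have hP := spectral_unitarymx H.
have /mxOverP hr := hermitian_spectral_diag_real hH.
exists (spectralmx H), (fun i => complex.Re (spectral_diag H 0 i)); split=> //.
rewrite {1}(spectral_eq (hermitian_normalmx hH)).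
suff -> : rdiag (fun i => complex.Re (spectral_diag H 0 i))
  = diag_mx (spectral_diag H) by [].
by congr diag_mx; apply/rowP => i; rewrite mxE RRe_real.
Qed.

Lemma eigdec_calc n (f : R -> R) (H U : 'M[R[i]]_n) d :
  eigdec H U d -> eigdec (mxcalc f H) U (f \o d).
Proof. by move=> hd; split; [case: hd | exact: mxcalcE]. Qed.

Lemma rdiag_perm n (d : 'I_n -> R) (s : 'S_n) :
  rdiag (d \o s) = perm_mx s *m rdiag d *m (perm_mx s)^t*.
Proof.
rewrite tr_perm_mx map_perm_mx -row_permE -[s in perm_mx s^-1]invgK -col_permE.
apply/matrixP => i j; rewrite !mxE /= ?invgK.
by rewrite (inj_eq perm_inj).
Qed.

Lemma perm_mx_unitary n (s : 'S_n) : (perm_mx s : 'M[R[i]]_n) \is unitarymx.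
Proof.
apply/unitarymxP; rewrite tr_perm_mx map_perm_mx -perm_mxM.
by rewrite mulgV perm_mx1.
Qed.

Definition noninc n (d : 'I_n -> R) :=
  forall i j : 'I_n, (i <= j)%N -> d j <= d i.

Lemma sort_perm n (d : 'I_n -> R) : exists s : 'S_n, noninc (d \o s).
Proof.
pose t := [tuple d i | i < n].
have st : size (sort >=%R t) == n by rewrite size_sort size_tuple.
have /tuple_permP [s es] : perm_eq (Tuple st) t by rewrite /= perm_sort.
exists s => i j ij.
have e (a : 'I_n) : d (s a) = nth 0 (sort >=%R t) a.
  by rewrite -/(tval (Tuple st)) es -tnth_nth !tnth_mktuple.
rewrite /= !e; move: ij; rewrite leq_eqVlt => /predU1P [-> //|ij].
have := sort_sorted (@ge_total _ _) t.
move/(sorted_ltn_nth (rev_trans le_trans)); apply=> //.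
- by rewrite inE size_sort size_tuple.
- by rewrite inE size_sort size_tuple.
Qed.

Lemma eigdec_sorted n (H : 'M[R[i]]_n) : H^t* = H ->
  exists U d, eigdec H U d /\ noninc d.
Proof.
move=> /eigdec_ex [U [d [hU ->]]]; have [s hs] := sort_perm d.
exists (perm_mx s *m U), (d \o s); split; last exact: hs.
split; first by rewrite mul_unitarymx ?perm_mx_unitary.
have hP := perm_mx_unitary s.
rewrite rdiag_perm adj_mul !mulmxA -[_ *m _ *m perm_mx s]mulmxA.
rewrite (adj_unitary hP) mulmx1 -[_ *m _^t* *m perm_mx s]mulmxA.
by rewrite (adj_unitary hP) mulmx1.
Qed.

Lemma sqnormE k (x : 'rV[R[i]]_k) : (x *m x^t*) 0 0 = \sum_i `|x 0 i| ^+ 2.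
Proof. by rewrite mxE; apply: eq_bigr => i _; rewrite !mxE normCK. Qed.

Lemma sqnorm_ge0 k (x : 'rV[R[i]]_k) : 0 <= (x *m x^t*) 0 0.
Proof. by rewrite sqnormE sumr_ge0 // => i _; rewrite exprn_ge0. Qed.

Lemma rdiag_form k (d : 'I_k -> R) (x : 'rV[R[i]]_k) :
  (x *m rdiag d *m x^t*) 0 0 = \sum_i (d i)%:C * `|x 0 i| ^+ 2.
Proof.
rewrite mxE; apply: eq_bigr => i _.
by rewrite mul_mx_diag !mxE normCK mulrAC mulrC mulrA.
Qed.

Lemma eigdec_ge0 n (H U : 'M[R[i]]_n) d : eigdec H U d ->
  (forall x : 'rV[R[i]]_n, 0 <= (x *m H *m x^t*) 0 0) -> forall i, 0 <= d i.
Proof.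
move=> [hU ->] hx i; have := hx (delta_mx 0 i *m U).
have e : U *m U^t* = 1%:M by apply/unitarymxP.
rewrite adj_mul !mulmxA -[_ *m U *m U^t*]mulmxA e mulmx1.
rewrite -[_ *m U *m U^t*]mulmxA e mulmx1 rdiag_form (bigD1 i) //= big1 ?addr0.
  by rewrite mxE !eqxx normr1 expr1n mulr1 lecR.
by move=> j ji; rewrite mxE (negPf ji) andbF normr0 expr0n mulr0.
Qed.

Lemma gram_herm m n (T : 'M[R[i]]_(m, n)) : (T^t* *m T)^t* = T^t* *m T.
Proof. by rewrite adj_mul trmxCK. Qed.

Lemma gram_form m n (T : 'M[R[i]]_(m, n)) (x : 'rV[R[i]]_n) :
  x *m (T^t* *m T) *m x^t* = (x *m T^t*) *m (x *m T^t*)^t*.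
Proof. by rewrite adj_mul trmxCK !mulmxA. Qed.

Lemma eigdec_gram_ge0 m n (T : 'M[R[i]]_(m, n)) U d :
  eigdec (T^t* *m T) U d -> forall i, 0 <= d i.
Proof. by move=> /eigdec_ge0; apply=> x; rewrite gram_form sqnorm_ge0. Qed.

End Spectral.

(** * Interlacing and determinants of compressions *)

(** j linear conditions on j + 1 free coordinates have a nonzero solution. *)
Lemma ex_prefix_vec (F : fieldType) k n (G : 'M[F]_(k, n)) (j : nat) :
  (j < k)%N -> exists2 a : 'rV[F]_k, a != 0 &
    (forall i : 'I_k, (j < i)%N -> a 0 i = 0) /\
    (forall l : 'I_n, (l < j)%N -> (a *m G) 0 l = 0).
Proof.
move=> jk.
pose E : 'M[F]_(j.+1, k) := pid_mx j.+1.
pose M := E *m G *m (pid_mx j : 'M_(n, j)).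
have : kermx M != 0.
  by rewrite -mxrank_eq0 mxrank_ker -lt0n subn_gt0 ltnS rank_leq_col.
move=> /rowV0Pn [v /sub_kermxP vM v0].
exists (v *m E).
  by rewrite mulmx_free_eq0 // /row_free rank_pid_mx.
split=> [i ji|l lj].
  rewrite mxE big1 // => q _; rewrite mxE -[(q < _)%N]/(q <= j)%N.
  by case: eqP => [e|]; rewrite ?mulr0 //= leqNgt e ji mulr0.
move: vM; rewrite /M !mulmxA => /rowP /(_ (Ordinal lj)).
rewrite [LHS]mxE (bigD1 l) //= big1 ?addr0; last first.
  move=> i; rewrite -val_eqE => /negPf /= e.
  by rewrite [pid_mx _ _ _]mxE /= e mulr0.
by rewrite [pid_mx _ _ _]mxE /= eqxx lj mulr1 => ->; rewrite mxE.
Qed.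

Section Interlacing.
Variable R : realType.
Implicit Types (m n k : nat).

Lemma isometry_sqnorm k n (W : 'M[R[i]]_(k, n)) (x : 'rV[R[i]]_k) :
  W \is unitarymx -> (x *m W) *m (x *m W)^t* = x *m x^t*.
Proof. by move=> hW; rewrite adj_mul mulmxA mulmxtVK. Qed.

Lemma eigdec_form n (H U : 'M[R[i]]_n) d (x : 'rV[R[i]]_n) : eigdec H U d ->
  x *m H *m x^t* = (x *m U^t*) *m rdiag d *m (x *m U^t*)^t*.
Proof. by case=> hU ->; rewrite adj_mul trmxCK !mulmxA. Qed.

(** Courant-Fischer comparison, with C acting on a subspace embedded by W. It
    covers both Cauchy interlacing and Weyl monotonicity. By dimension count
    some nonzero x in the span of the first j + 1 eigenvectors of C is mapped
    by W into the span of the eigenvectors of H of index at least j; the form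
    of C at x is at least c_j |x|^2, that of H at x W at most d_j |x|^2. *)
Lemma eig_le n k (H U : 'M[R[i]]_n) d (C Z : 'M[R[i]]_k) c
    (W : 'M[R[i]]_(k, n)) (j : 'I_k) (l : 'I_n) :
  eigdec H U d -> noninc d -> eigdec C Z c -> noninc c -> W \is unitarymx ->
  (forall x : 'rV[R[i]]_k,
     (x *m C *m x^t*) 0 0 <= (x *m W *m H *m (x *m W)^t*) 0 0) ->
  j = l :> nat -> c j <= d l.
Proof.
move=> hH sd hC sc hW hle jl.
have [hU _] := hH; have [hZ _] := hC.
have hUt : U^t* \is unitarymx by rewrite trmxC_unitary.
have [a a0 [aj al]] := ex_prefix_vec (Z *m W *m U^t*) (ltn_ord j).
have := hle (a *m Z).
rewrite (eigdec_form _ hH) (eigdec_form _ hC) (mulmxtVK _ hZ).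
have -> : a *m Z *m W *m U^t* = a *m (Z *m W *m U^t*) by rewrite !mulmxA.
set z := a *m _ in al *; rewrite !rdiag_form => le1.
have zz : \sum_i `|z 0 i| ^+ 2 = \sum_i `|a 0 i| ^+ 2.
  rewrite -!sqnormE /z !mulmxA (isometry_sqnorm _ hUt).
  by rewrite (isometry_sqnorm _ hW) (isometry_sqnorm _ hZ).
have s0 : 0 < \sum_i `|a 0 i| ^+ 2.
  rewrite -sqnormE lt_def sqnorm_ge0 andbT sqnormE.
  apply: contra a0; rewrite psumr_eq0; last by move=> i _; rewrite exprn_ge0.
  move=> /allP h; apply/eqP/rowP => i; rewrite mxE; apply/eqP.
  by have := h i (mem_index_enum i); rewrite /= expf_eq0 normr_eq0.
have le2 : (c j)%:C * \sum_i `|a 0 i| ^+ 2 <= \sum_i (c i)%:C * `|a 0 i| ^+ 2.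
  rewrite mulr_sumr; apply: ler_sum => i _.
  have [ij|ij] := leqP i j.
    by rewrite ler_wpM2r ?exprn_ge0 // lecR sc.
  by rewrite aj // normr0 expr0n !mulr0.
have le3 : \sum_i (d i)%:C * `|z 0 i| ^+ 2 <= (d l)%:C * \sum_i `|a 0 i| ^+ 2.
  rewrite -zz mulr_sumr; apply: ler_sum => i _.
  have [ij|ij] := leqP l i.
    by rewrite ler_wpM2r ?exprn_ge0 // lecR sd.
  by rewrite al ?jl // normr0 expr0n !mulr0.
have := le_trans le2 (le_trans le1 le3).
by rewrite ler_pM2r // lecR.
Qed.

(** The squared distance from y to the span of the orthonormal rows of V is
    nonnegative. *)
Lemma bessel k n (V : 'M[R[i]]_(k, n)) (y : 'rV[R[i]]_n) : V \is unitarymx ->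
  ((y *m V^t*) *m (y *m V^t*)^t*) 0 0 <= (y *m y^t*) 0 0.
Proof.
move=> hV; have := sqnorm_ge0 (y - y *m V^t* *m V).
have -> : (y - y *m V^t* *m V)^t* = y^t* - V^t* *m V *m y^t*.
  by rewrite raddfB /= raddfB /= -/(_^t*) !adj_mul trmxCK mulmxA.
rewrite mulmxBr !mulmxBl !mulmxA (mulmxtVK _ hV) subrr subr0.
by rewrite adj_mul trmxCK !mulmxA [X in 0 <= X]mxE [X in 0 <= _ + X]mxE subr_ge0.
Qed.

Lemma det_adj k (M : 'M[R[i]]_k) : \det (M^t*) = (\det M)^*%R.
Proof. by rewrite det_map_mx det_tr. Qed.

Lemma det_rdiag k (c : 'I_k -> R) : \det (rdiag c) = (\prod_i c i)%:C.
Proof. by rewrite det_diag rmorph_prod; apply: eq_bigr => i _; rewrite mxE. Qed.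

Lemma det_eigdec k (C Z : 'M[R[i]]_k) c :
  eigdec C Z c -> \det C = (\prod_i c i)%:C.
Proof.
move=> [hZ ->]; rewrite !det_mulmx mulrAC -det_mulmx (adj_unitary hZ) det1 mul1r.
exact: det_rdiag.
Qed.

Lemma unitary_leq k n (V : 'M[R[i]]_(k, n)) : V \is unitarymx -> (k <= n)%N.
Proof. by move=> /mxrank_unitary <-; apply: rank_leq_col. Qed.

(** By [bessel], the Gram matrix of V L W^* lies below the compression of
    L^* L by W, so its eigenvalues are bounded one by one by those of L^* L. *)
Lemma det_compress n k (V W : 'M[R[i]]_(k, n)) (L U : 'M[R[i]]_n) d :
  V \is unitarymx -> W \is unitarymx -> eigdec (L^t* *m L) U d -> noninc d ->
  `|\det (V *m L *m W^t*)| ^+ 2 <= (\prod_(i < n | (i < k)%N) d i)%:C.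
Proof.
move=> hV hW hd sd; set F := V *m L *m W^t*.
have kn := unitary_leq hV.
have [Z [c [hc sc]]] := eigdec_sorted (gram_herm F).
have -> : `|\det F| ^+ 2 = \det (F^t* *m F).
  by rewrite det_mulmx det_adj normCK mulrC.
rewrite (det_eigdec hc) lecR (big_ord_narrow kn).
apply: ler_prod => i _; rewrite (eigdec_gram_ge0 hc) /=.
apply: (eig_le hd sd hc sc hW) => // x.
rewrite !gram_form; have := bessel (x *m W *m L^t*) hV.
by rewrite /F !adj_mul !trmxCK !mulmxA.
Qed.

Lemma schmidt_fact k n (F : 'M[R[i]]_(k, n)) : (k <= n)%N ->
  F *m (schmidt F)^t* *m schmidt F = F.
Proof.
move=> kn; have hV : schmidt F \is unitarymx by apply: schmidt_unitarymx.
have /submxP [S e] := schmidt_sub F.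
by rewrite {1}e (mulmxtVK _ hV) -e.
Qed.

(** Let the rows of Pk be the top k eigenvectors of T^* T, so that
    Pk (T^* T) = tk Pk with tk diagonal. Then Q = Pk D satisfies
    Q K^* L = tk Q. Orthonormalizing the rows, Q = S Q', shows that tk is
    similar through S to the compression of K^* L by Q'. A second
    orthonormalization Q' K^* = R V splits the determinant of that compression
    into two determinants, one of a compression of K and one of L. *)
Lemma log_majorization n (G D Y P U1 U2 : 'M[R[i]]_n) t q l k :
  G^t* = G -> D^t* = D ->
  let T := G *m Y *m D in let K := G *m G *m Y in let L := Y *m D *m D in
  eigdec (T^t* *m T) P t -> noninc t ->
  eigdec (K^t* *m K) U1 q -> noninc q ->
  eigdec (L^t* *m L) U2 l -> noninc l ->
  (k <= n)%N ->
  (\prod_(i < n | (i < k)%N) t i) ^+ 2 <=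
    (\prod_(i < n | (i < k)%N) q i) * \prod_(i < n | (i < k)%N) l i.
Proof.
move=> hG hD T K L ht st hq sq hl sl kn.
have [hP eP] := ht.
pose J : 'M[R[i]]_(k, n) := pid_mx k.
have hJ : J \is unitarymx.
  apply/unitarymxP; rewrite tr_pid_mx map_pid_mx pid_mx_id //.
  exact: pid_mx_1.
pose Pk := J *m P; have hPk : Pk \is unitarymx by rewrite mul_unitarymx.
pose tk i := t (widen_ord kn i).
have eJ : J *m rdiag t = rdiag tk *m J.
  apply/matrixP => i j; rewrite mul_mx_diag mul_diag_mx !mxE.
  case: eqP => [e|_]; rewrite /= ?mul0r ?mulr0 // ltn_ord mulr1 mul1r.
  by congr (t _)%:C; apply/val_inj; rewrite /= e.
have eT : Pk *m (T^t* *m T) = rdiag tk *m Pk.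
  by rewrite eP /Pk !mulmxA (mulmxtVK _ hP) eJ.
have eTT : T^t* *m T = D *m K^t* *m Y *m D.
  by rewrite /T /K !adj_mul hG hD !mulmxA.
pose Q := Pk *m D.
have eQ : Q *m K^t* *m L = rdiag tk *m Q.
  by rewrite /Q mulmxA -eT eTT /L !mulmxA.
have := schmidt_fact Q kn.
have : schmidt Q \is unitarymx by apply: schmidt_unitarymx.
move: (schmidt Q) => Q' hQ'; set S := Q *m Q'^t* => eS.
have eDS : rdiag tk *m S = S *m (Q' *m K^t* *m L *m Q'^t*).
  by rewrite /S mulmxA -eQ -{1}eS /S !mulmxA.
have eD : rdiag tk = S *m (Q' *m K^t* *m Y *m D *m Pk^t*).
  by rewrite !mulmxA eS -[LHS](mulmxtVK _ hPk) -eT eTT /Q !mulmxA.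
have ge0 q' U' (M : 'M[R[i]]_n) : eigdec (M^t* *m M) U' q' ->
    0 <= \prod_(i < n | (i < k)%N) q' i.
  by move=> h; apply: prodr_ge0 => i _; apply: (eigdec_gram_ge0 h).
have tE : (\prod_(i < n | (i < k)%N) t i)%:C = \det (rdiag tk).
  by rewrite det_rdiag (big_ord_narrow kn).
(* When S is singular the diagonal matrix tk, a multiple of S, is too, so
   the left-hand side vanishes. *)
have [S0|S0] := eqVneq (\det S) 0.
  move: tE; rewrite eD det_mulmx S0 mul0r => /complexI ->.
  by rewrite expr0n; apply: mulr_ge0; [exact: ge0 hq | exact: ge0 hl].
have {}eD : \det (rdiag tk) = \det (Q' *m K^t* *m L *m Q'^t*).
  apply: (mulfI S0); rewrite mulrC -(det_mulmx (rdiag tk) S) eDS.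
  exact: det_mulmx.
have := schmidt_fact (Q' *m K^t*) kn.
have : schmidt (Q' *m K^t*) \is unitarymx by apply: schmidt_unitarymx.
move: (schmidt _) => V hV eV.
have key : ((\prod_(i < n | (i < k)%N) t i) ^+ 2)%:C =
    `|\det (V *m K *m Q'^t*)| ^+ 2 * `|\det (V *m L *m Q'^t*)| ^+ 2.
  have -> : V *m K *m Q'^t* = (Q' *m K^t* *m V^t*)^t*.
    by rewrite !adj_mul !trmxCK mulmxA.
  rewrite det_adj norm_conjC -exprMn -normrM -det_mulmx.
  have -> : Q' *m K^t* *m V^t* *m (V *m L *m Q'^t*) = Q' *m K^t* *m L *m Q'^t*.
    by rewrite !mulmxA eV.
  rewrite -eD -tE ger0_norm; first exact: rmorphXn.
  by rewrite ler0c; exact: ge0 ht.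
rewrite -lecR key rmorphM /=.
have cq := det_compress hV hQ' hq sq; have cl := det_compress hV hQ' hl sl.
by apply: (ler_pM _ _ cq cl); exact: exprn_ge0.
Qed.
End Interlacing.

(** * Majorization *)

Section Major.
Variable R : realType.
Implicit Types (u v w a : nat -> R).

(** Summation by parts: a nonincreasing nonnegative weight preserves the
    nonnegativity of partial sums. *)
Lemma abel_ge w a m :
  (forall i, (i < m)%N -> 0 <= w i) ->
  (forall i j, (i <= j < m)%N -> w j <= w i) ->
  (forall k, (k <= m)%N -> 0 <= \sum_(i < k) a i) ->
  0 <= \sum_(i < m) w i * a i.
Proof.
case: m => [|m] w0 wd ha; first by rewrite big_ord0.
suff h k : (k <= m)%N ->
    w k * \sum_(i < k.+1) a i <= \sum_(i < k.+1) w i * a i.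
  by apply: le_trans (h m (leqnn m)); rewrite mulr_ge0 ?w0 ?ha.
elim: k => [_|k IH km]; first by rewrite !big_ord_recr !big_ord0 /= !add0r.
rewrite big_ord_recr [in leRHS]big_ord_recr /= mulrDr lerD2r.
apply: le_trans (IH (ltnW km)); apply: ler_wpM2r.
  by apply: ha; rewrite ltnS ltnW.
by apply: wd; rewrite leqnSn ltnS.
Qed.

Lemma ln_prod u k : (forall i, (i < k)%N -> 0 < u i) ->
  ln (\prod_(i < k) u i) = \sum_(i < k) ln (u i).
Proof.
elim: k => [|k IH] hu; first by rewrite !big_ord0 ln1.
have hk i : (i < k)%N -> 0 < u i by move=> ik; apply: hu; rewrite ltnW.
have pk : 0 < \prod_(i < k) u i by apply: prodr_gt0 => i _; apply: hk.
by rewrite !big_ord_recr /= lnM ?posrE // ?hu // IH.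
Qed.

(** If v is positive, then u_i - v_i >= v_i ln (u_i / v_i), and the partial
    sums of ln (u_i / v_i) are nonnegative, so [abel_ge] applies with the
    weight v. Trailing zeros of v are removed by induction. *)
Lemma weak_log_major u v m :
  (forall i, (i < m)%N -> 0 <= u i) -> (forall i, (i < m)%N -> 0 <= v i) ->
  (forall i j, (i <= j < m)%N -> v j <= v i) ->
  (forall k, (k <= m)%N -> \prod_(i < k) v i <= \prod_(i < k) u i) ->
  \sum_(i < m) v i <= \sum_(i < m) u i.
Proof.
elim: m => [|m IH] u0 v0 vd hp; first by rewrite !big_ord0.
have := v0 m (leqnn _); rewrite le_eqVlt => /predU1P [vm|vm].
  rewrite !big_ord_recr /= -vm addr0.
  apply: (@le_trans _ _ (\sum_(i < m) u i)); last by rewrite lerDl u0.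
  apply: IH => [i im|i im|i j /andP[ij jm]|k km].
  - by apply: u0; rewrite ltnW.
  - by apply: v0; rewrite ltnW.
  - by apply: vd; rewrite ij ltnW.
  - by apply: hp; rewrite ltnW.
have vp i : (i < m.+1)%N -> 0 < v i.
  by move=> im; apply: lt_le_trans vm _; apply: vd; rewrite -ltnS im leqnn.
have prodv k : (k <= m.+1)%N -> 0 < \prod_(i < k) v i.
  by move=> km; apply: prodr_gt0 => i _; apply: vp; apply: leq_trans km.
have up i : (i < m.+1)%N -> 0 < u i.
  move=> im; rewrite lt_def u0 // andbT; apply: contraTneq (leqnn m.+1) => ui.
  have := lt_le_trans (prodv _ (leqnn _)) (hp _ (leqnn _)).
  by rewrite (bigD1 (Ordinal im)) //= ui mul0r ltxx.
rewrite -subr_ge0 -sumrB.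
apply: (@le_trans _ _ (\sum_(i < m.+1) v i * (ln (u i) - ln (v i)))).
  apply: (@abel_ge v (fun i => ln (u i) - ln (v i))) => // k km.
  rewrite sumrB subr_ge0 -!ln_prod; last 2 first.
  - by move=> i ik; apply: up; apply: leq_trans km.
  - by move=> i ik; apply: vp; apply: leq_trans km.
  rewrite ler_ln ?posrE ?prodv ?hp //.
  exact: lt_le_trans (prodv _ km) (hp _ km).
apply: ler_sum => i _.
have [ui vi] := (up i (ltn_ord i), vp i (ltn_ord i)).
rewrite -ln_div ?posrE //.
have h : ln (u i / v i) <= u i / v i - 1.
  rewrite -[X in ln X](subrK 1) [X in ln X]addrC le_ln1Dx //.
  by rewrite -subr_gt0 opprK subrK divr_gt0.
apply: le_trans (ler_wpM2l (ltW vi) h) _.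
by rewrite mulrBr mulr1 mulrCA divff ?mulr1 // gt_eqF.
Qed.

Lemma extend_ord n (d : 'I_n -> R) :
  exists e : nat -> R, forall i : 'I_n, e i = d i.
Proof.
exists (fun i => if insub i is Some j then d j else 0) => i.
by rewrite valK.
Qed.

Lemma big_ord_prefix T (idx : T) op n k (e : nat -> T) (d : 'I_n -> T) :
  (forall i : 'I_n, e i = d i) -> (k <= n)%N ->
  \big[op/idx]_(i < n | (i < k)%N) d i = \big[op/idx]_(i < k) e i.
Proof.
by move=> ed kn; rewrite (big_ord_widen _ e kn); apply: eq_bigr => i _; rewrite ed.
Qed.

Lemma weak_log_major_ord n (u v : 'I_n -> R) :
  (forall i, 0 <= u i) -> (forall i, 0 <= v i) -> noninc v ->
  (forall k, (k <= n)%N ->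
    \prod_(i < n | (i < k)%N) v i <= \prod_(i < n | (i < k)%N) u i) ->
  forall k, (k <= n)%N ->
    \sum_(i < n | (i < k)%N) v i <= \sum_(i < n | (i < k)%N) u i.
Proof.
have [u' eu] := extend_ord u; have [v' ev] := extend_ord v.
move=> u0 v0 vd hp k kn.
rewrite (big_ord_prefix _ _ ev kn) (big_ord_prefix _ _ eu kn).
apply: weak_log_major => [i ik|i ik|i j /andP [ij jk]|l lk].
- by rewrite (eu (Ordinal (leq_trans ik kn))).
- by rewrite (ev (Ordinal (leq_trans ik kn))).
- have jn := leq_trans jk kn.
  by rewrite (ev (Ordinal jn)) (ev (Ordinal (leq_ltn_trans ij jn))); apply: vd.
- have ln := leq_trans lk kn.
  by rewrite -(big_ord_prefix _ _ ev ln) -(big_ord_prefix _ _ eu ln) hp.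
Qed.

(** Induction on the number of coordinates where u and v differ. Let k be the
    first index with u_k < v_k; comparing prefix sums gives some j < k with
    v_j < u_j. Moving the amount de from u_j to u_k makes u and v agree at j or
    at k. The new vector is a convex combination of u and of u with j and k
    exchanged, since v_k <= v_j makes the transfer shorter than u_j - u_k. *)
Lemma weak_major_gauge n (Phi : ('I_n -> R) -> R) :
  (forall x y, (forall i, 0 <= x i <= y i) -> Phi x <= Phi y) ->
  (forall (q : R) x (s : 'S_n), 0 <= q <= 1 ->
     Phi (fun i => (1 - q) * x i + q * x (s i)) <= Phi x) ->
  forall u v : 'I_n -> R,
  (forall i, 0 <= u i) -> (forall i, 0 <= v i) -> noninc v ->
  (forall k, (k <= n)%N ->
    \sum_(i < n | (i < k)%N) v i <= \sum_(i < n | (i < k)%N) u i) ->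
  Phi v <= Phi u.
Proof.
move=> mono conv u v; have [c] := ubnP #|[set i | u i != v i]|.
elim: c u => // c IH u hc u0 v0 vd hs.
have [/existsP [i0 hi0]|] := boolP [exists i, u i < v i]; last first.
  rewrite negb_exists => /forallP h; apply: mono => i.
  by rewrite v0 leNgt h.
have [k uk kmin] :=
  @arg_minnP _ i0 (fun i => u i < v i) (fun i => i : nat) hi0.
have below (i : 'I_n) : (i < k)%N -> v i <= u i.
  by move=> ik; rewrite leNgt; apply/negP => /kmin; rewrite leqNgt ik.
have [j jk uj] : exists2 j : 'I_n, (j < k)%N & v j < u j.
  apply/exists_inP; apply: contraT; rewrite negb_exists_in => /forall_inP h.
  have := hs k.+1 (ltn_ord k).
  rewrite (bigD1 k) //= [leRHS](bigD1 k) //= => h1.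
  suff h2 : \sum_(i < n | (i < k.+1)%N && (i != k)) u i <=
            \sum_(i < n | (i < k.+1)%N && (i != k)) v i.
    by have := lt_le_trans (ltr_leD uk h2) h1; rewrite ltxx.
  apply: ler_sum => i /andP [ik ne]; rewrite leNgt h //.
  by rewrite ltn_neqAle -ltnS ik andbT.
have jNk : j != k by rewrite -val_eqE /= ltn_eqF.
have vjk : v k <= v j by apply: vd; apply: ltnW.
pose de := Num.min (u j - v j) (v k - u k).
have de0 : 0 < de by rewrite /de lt_min !subr_gt0 uj uk.
have dej : de <= u j - v j by rewrite /de ge_min lexx.
have dek : de <= v k - u k by rewrite /de ge_min lexx orbT.
have ujk : 0 < u j - u k by lra.
pose q := de / (u j - u k).
have qe : q * (u j - u k) = de by rewrite /q divfK // gt_eqF.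
have q01 : 0 <= q <= 1.
  by rewrite /q ler_pdivrMr // mul1r divr_ge0 /= ?(ltW de0) ?(ltW ujk) //; lra.
pose u' i := (1 - q) * u i + q * u (tperm j k i).
have u'j : u' j = u j - de by rewrite /u' tpermL -qe; ring.
have u'k : u' k = u k + de by rewrite /u' tpermR -qe; ring.
have u'i i : i != j -> i != k -> u' i = u i.
  by move=> ij ik; rewrite /u' tpermD 1?eq_sym //; ring.
apply: le_trans (conv q u (tperm j k) q01); rewrite -/u'.
apply: IH => // [|i|m mn].
- move: hc; rewrite ltnS; apply: leq_trans.
  apply: proper_card; apply/properP; split.
    apply/subsetP => i; rewrite !inE; apply: contra => /eqP e.
    have [ij|ij] := eqVneq i j; first by move: uj; rewrite -ij e ltxx.
    have [ik|ik] := eqVneq i k; first by move: uk; rewrite -ik e ltxx.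
    by rewrite u'i ?e.
  have [h|h] := leP (u j - v j) (v k - u k).
    exists j; first by rewrite inE gt_eqF.
    by rewrite inE u'j /de (min_idPl h) opprB addrCA subrr addr0 eqxx.
  exists k; first by rewrite inE lt_eqF.
  by rewrite inE u'k /de (min_idPr (ltW h)) addrCA subrr addr0 eqxx.
- rewrite /u'; move: q01 => /andP [q0 q1].
  by rewrite addr_ge0 // mulr_ge0 ?u0 ?subr_ge0.
have [mk|km] := leqP m k.
  apply: ler_sum => i im; have ik := leq_trans im mk.
  have [->|ij] := eqVneq i j; first by rewrite u'j; lra.
  by rewrite u'i ?below // -val_eqE /= ltn_eqF.
apply: le_trans (hs m mn) _; rewrite le_eqVlt; apply/orP; left; apply/eqP.
have jm := ltn_trans jk km.
rewrite (bigD1 j) //= [RHS](bigD1 j) //= (bigD1 k) /= ?km 1?eq_sym //.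
rewrite [X in _ = _ + X](bigD1 k) /= ?km 1?eq_sym // u'j u'k.
under [X in _ = _ + (_ + X)]eq_bigr => i /andP [/andP [_ ij] ik] do rewrite u'i //.
ring.
Qed.

End Major.

(** * Convex functions on the unit interval *)

Section Convex.
Variable R : realType.

(** The optimal weight is c = a / p; for p = 0 a large c forces a = 0. *)
Lemma sqr_le_of_amgm (a p q : R) : 0 <= a -> 0 <= p -> 0 <= q ->
  (forall c : R, 0 < c -> 2 * a <= c * p + c^-1 * q) -> a ^+ 2 <= p * q.
Proof.
rewrite le_eqVlt => /predU1P [<- p0 q0 _|a0].
  by rewrite expr0n mulr_ge0.
rewrite le_eqVlt => /predU1P [<-|p0] q0 h.
  have c0 : 0 < q / a + 1 by rewrite ltr_wpDl // divr_ge0 // ltW.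
  have := h _ c0; rewrite mulr0 add0r -(ler_pM2l c0) mulVKf ?gt_eqF //.
  have : q / a * a = q by rewrite divfK // gt_eqF.
  nra.
have := h (a / p) (divr_gt0 a0 p0).
rewrite divfK ?gt_eqF // invf_div => h1.
have {h1} : a <= p / a * q by lra.
by rewrite mulrAC ler_pdivlMr // expr2.
Qed.

(** Every x of [0,1] is the midpoint of an endpoint and another point of
    [0,1], so any upper bound M can be halved; iterating, f x <= M / 2^m. *)
Lemma bounded_midpoint_le0 (f : R -> R) (M : R) :
  (forall x, 0 <= x <= 1 -> f x <= M) -> f 0 <= 0 -> f 1 <= 0 ->
  (forall x y, 0 <= x <= 1 -> 0 <= y <= 1 ->
     f ((x + y) / 2) <= (f x + f y) / 2) ->
  forall x, 0 <= x <= 1 -> f x <= 0.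
Proof.
move=> hM f0 f1 mid.
have half K : (forall x, 0 <= x <= 1 -> f x <= K) ->
    forall x, 0 <= x <= 1 -> f x <= K / 2.
  move=> hK x x01; have [x2|x2] := leP x (1 / 2).
    have h2 : 0 <= 2 * x <= 1 by lra.
    have := mid 0 (2 * x) ltac:(lra) h2.
    have -> : (0 + 2 * x) / 2 = x by field.
    have := hK _ h2; lra.
  have h2 : 0 <= 2 * x - 1 <= 1 by lra.
  have := mid 1 (2 * x - 1) ltac:(lra) h2.
  have -> : (1 + (2 * x - 1)) / 2 = x by field.
  have := hK _ h2; lra.
have iter m : forall x, 0 <= x <= 1 -> f x <= M / 2 ^+ m.
  elim: m => [|m IH] x x01; first by rewrite expr0 divr1 hM.
  by have := half _ IH x x01; rewrite exprS invfM mulrA mulrAC.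
move=> x x01; rewrite leNgt; apply/negP => fx.
have [m hm] : exists m : nat, M / f x < m%:R.
  exists (Num.bound (M / f x)); apply: archi_boundP.
  by rewrite divr_ge0 ?(le_trans (ltW fx)) ?hM // ltW.
have := iter m x x01; rewrite ler_pdivlMr ?exprn_gt0 //.
move: hm; rewrite ltr_pdivrMr // => hm.
have : (m%:R : R) <= 2 ^+ m by rewrite -natrX ler_nat ltnW // ltn_expl.
move/(ler_wpM2r (ltW fx)) => h1 h2.
by move: (lt_le_trans hm h1); rewrite mulrC ltNge h2.
Qed.

Definition convex01 (f : R -> R) := forall x y q : R,
  0 <= x <= 1 -> 0 <= y <= 1 -> 0 <= q <= 1 ->
  f ((1 - q) * x + q * y) <= (1 - q) * f x + q * f y.

Lemma convex_of_midpoint (f : R -> R) (M : R) :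
  (forall x, 0 <= x <= 1 -> 0 <= f x <= M) ->
  (forall x y, 0 <= x <= 1 -> 0 <= y <= 1 ->
     f ((x + y) / 2) <= (f x + f y) / 2) -> convex01 f.
Proof.
move=> hM mid x y q hx hy hq; rewrite -subr_le0.
have fx := hM x hx; have fy := hM y hy.
have inn t : 0 <= t <= 1 -> 0 <= (1 - t) * x + t * y <= 1 by move=> ht; nra.
pose g t := f ((1 - t) * x + t * y) - ((1 - t) * f x + t * f y).
apply: (@bounded_midpoint_le0 g M) q hq => [t ht| | |s t hs ht].
- have := hM _ (inn t ht).
  have : 0 <= (1 - t) * f x + t * f y by nra.
  rewrite /g; lra.
- by rewrite /g subr0 !mul1r !mul0r !addr0 subrr.
- by rewrite /g subrr !mul1r !mul0r !add0r subrr.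
have := mid _ _ (inn s hs) (inn t ht); rewrite /g.
have -> : ((1 - s) * x + s * y + ((1 - t) * x + t * y)) / 2
  = (1 - (s + t) / 2) * x + (s + t) / 2 * y by field.
lra.
Qed.

(** By symmetry mu <= 1/2. With a = (1-p)/2 and m = a + p mu, both a and mu lie
    in [0, m]. Bounding f a and f mu by the chord over [0, m], with weights 1
    and p, gives the first inequality because a + p mu = m. The second holds
    because m lies between a and 1 - a, where f takes the same value. *)
Lemma symmetric_convex_slopes (f : R -> R) (mu p : R) :
  convex01 f -> (forall t, f (1 - t) = f t) -> 0 <= mu <= 1 -> 0 < p < 1 ->
  1 / p * (f ((1 - p) / 2) - f ((1 - p) / 2 + p * mu)) <= f 0 - f mu /\
  0 <= 1 / p * (f ((1 - p) / 2) - f ((1 - p) / 2 + p * mu)).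
Proof.
move=> cf sf hmu hp.
wlog mu2 : mu hmu / mu <= 1 / 2.
  move=> H; have [|mu2] := leP mu (1 / 2); first exact: H.
  have := H (1 - mu) ltac:(lra) ltac:(lra); rewrite sf.
  have -> : (1 - p) / 2 + p * (1 - mu) = 1 - ((1 - p) / 2 + p * mu) by field.
  by rewrite sf.
set a := (1 - p) / 2; set m := a + p * mu.
have p0 : 0 < p by lra.
have a0 : 0 < a by rewrite /a; lra.
have am : a <= m by rewrite /m; nra.
have m2 : m <= 1 / 2 by rewrite /m /a; nra.
have m0 : 0 < m by lra.
have mum : mu <= m by rewrite /m /a; nra.
have chord x : 0 <= x <= m -> f x <= (1 - x / m) * f 0 + x / m * f m.
  move=> hx; have := cf 0 m (x / m); rewrite mulr0 add0r divfK ?gt_eqF //.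
  apply; [lra|lra|].
  by rewrite ler_pdivrMr // divr_ge0 /=; lra.
have h1 := chord a ltac:(lra); have h2 := chord mu ltac:(lra).
have e : a / m = 1 - p * (mu / m).
  apply/eqP; rewrite eq_sym subr_eq mulrA -mulrDl; apply/eqP.
  by rewrite divff // gt_eqF.
split.
  rewrite mulrC mul1r ler_pdivrMr //.
  have := ler_wpM2l (ltW p0) h2; rewrite e in h1; lra.
apply: mulr_ge0; first by rewrite divr_ge0 // ltW.
rewrite subr_ge0.
have d0 : 0 < 1 - 2 * a by rewrite /a; lra.
have := cf a (1 - a) ((m - a) / (1 - 2 * a)); rewrite sf.
have -> : (1 - (m - a) / (1 - 2 * a)) * a + (m - a) / (1 - 2 * a) * (1 - a) = m.
  by field; rewrite gt_eqF.
rewrite -mulrDl subrK mul1r; apply; [lra|lra|].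
rewrite ler_pdivrMr // divr_ge0 /=; lra.
Qed.

Lemma le_mean_of_sqr (m x y : R) : 0 <= m -> 0 <= x -> 0 <= y ->
  m ^+ 2 <= x * y -> m <= (x + y) / 2.
Proof.
move=> m0 x0 y0 h; rewrite -ler_sqr ?nnegrE //; last by lra.
by apply: le_trans h _; have := sqr_ge0 (x - y); lra.
Qed.
End Convex.

(** * Powers of positive semidefinite matrices *)

Section Powers.
Variables (R : realType) (n : nat).
Implicit Types (A M : 'M[R[i]]_n).

Lemma eq_rdiag (x y : 'I_n -> R) : x =1 y -> rdiag x = rdiag y.
Proof. by move=> e; congr diag_mx; apply/rowP => i; rewrite !mxE e. Qed.

Lemma rdiag_mul (x y : 'I_n -> R) :
  rdiag x *m rdiag y = rdiag (fun i => x i * y i).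
Proof.
apply/matrixP => i j; rewrite mul_diag_mx !mxE.
by case: eqP => _; rewrite ?mulr1n ?mulr0n ?mulr0 // -rmorphM.
Qed.

Lemma psd_eigdec A : psdmx A ->
  exists U a, eigdec A U a /\ forall i, 0 <= a i.
Proof.
move=> [/herm_adjP hA hpos]; have [U [a ha]] := eigdec_ex hA.
exists U, a; split=> //; apply: (eigdec_ge0 ha) => x.
by have := hpos (x^t*); rewrite trmxCK.
Qed.

Lemma mxpowR_herm A t : psdmx A -> (mxpowR A t)^t* = mxpowR A t.
Proof.
by move=> /psd_eigdec [U [a [ha _]]]; apply: eigdec_herm (eigdec_calc _ ha).
Qed.

(** Nonnegative exponents cannot cancel, so this holds for x = 0 as well: there
    0 to the power 0 is 1. *)
Lemma powR_addr_ge0 (x s t : R) : 0 <= s -> 0 <= t ->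
  powR x (s + t) = powR x s * powR x t.
Proof.
rewrite le_eqVlt => /predU1P [<- _|s0 t0]; first by rewrite add0r powRr0 mul1r.
by rewrite powRD // gt_eqF // ltr_wpDr.
Qed.

Lemma mxpowR_mul A s t : psdmx A -> 0 <= s -> 0 <= t ->
  mxpowR A s *m mxpowR A t = mxpowR A (s + t).
Proof.
move=> /psd_eigdec [U [a [ha a0]]] s0 t0; rewrite /mxpowR !(mxcalcE _ ha).
have hU : U \is unitarymx by case: ha.
rewrite !mulmxA (mulmxtVK _ hU) -[_ *m rdiag _ *m rdiag _]mulmxA rdiag_mul.
rewrite (eq_rdiag (y := (@powR R)^~ (s + t) \o a)) // => i /=.
by rewrite powR_addr_ge0.
Qed.

Lemma mxpowR1 A : psdmx A -> mxpowR A 1 = A.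
Proof.
move=> /psd_eigdec [U [a [ha a0]]]; rewrite /mxpowR (mxcalcE _ ha).
rewrite (eq_rdiag (y := a)); first by case: ha.
by move=> i; rewrite /= powRr1.
Qed.

Lemma mxpowR0 A : psdmx A -> mxpowR A 0 = 1%:M.
Proof.
move=> /psd_eigdec [U [a [ha a0]]]; rewrite /mxpowR (mxcalcE _ ha).
have hU : U \is unitarymx by case: ha.
suff -> : rdiag ((powR (R:=R))^~ 0 \o a) = 1%:M.
  by rewrite mulmx1 (adj_unitary hU).
by apply/matrixP => i j; rewrite !mxE /= powRr0.
Qed.

(** A crude submultiplicative size, used only to bound A^t X B^(1-t)
    uniformly in t. *)
Definition entry_le M (c : R) := forall i j, `|M i j| <= c%:C.

Lemma entry_le_mul M1 M2 c1 c2 : entry_le M1 c1 -> entry_le M2 c2 ->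
  entry_le (M1 *m M2) (n%:R * (c1 * c2)).
Proof.
move=> h1 h2 i j; rewrite mxE; apply: le_trans (ler_norm_sum _ _ _) _.
apply: (@le_trans _ _ (\sum_(k < n) (c1 * c2)%:C)).
  by apply: ler_sum => k _; rewrite normrM rmorphM /= ler_pM.
by rewrite sumr_const card_ord mulr_natl rmorphMn.
Qed.

Lemma entry_le_adj M c : entry_le M c -> entry_le (M^t*) c.
Proof. by move=> h i j; rewrite !mxE norm_conjC. Qed.

Lemma entry_le_unitary M : M \is unitarymx -> entry_le M 1.
Proof.
move=> hM i j; rewrite rmorph1.
have : (row i M *m (row i M)^t*) 0 0 = 1.
  have /unitarymxP /matrixP /(_ i i) := hM; rewrite !mxE eqxx; apply: etrans.
  by apply: eq_bigr => k _; rewrite !mxE.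
rewrite sqnormE (bigD1 j) //= mxE => e.
rewrite -(@expr_le1 _ 2) // -e lerDl sumr_ge0 // => k _; exact: exprn_ge0.
Qed.

Lemma entry_le_rdiag (d : 'I_n -> R) c : (forall i, 0 <= d i <= c) ->
  entry_le (rdiag d) c.
Proof.
move=> h i j; rewrite !mxE; have /andP [d0 dc] := h j.
case: eqP => [->|_]; first by rewrite mulr1n ger0_norm ?ler0c // lecR.
by rewrite mulr0n normr0 ler0c (le_trans d0).
Qed.

Lemma entry_le_ex M : exists c, entry_le M c.
Proof.
exists (\sum_i \sum_j complex.Re `|M i j|) => i j.
have e k l : `|M k l| = (complex.Re `|M k l|)%:C by rewrite RRe_real // normr_real.
have r0 k l : 0 <= complex.Re `|M k l| by rewrite -ler0c -e.
rewrite {1}e lecR (bigD1 i) //= (bigD1 j) //= -addrA lerDl addr_ge0 //.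
  by apply: sumr_ge0 => l _; apply: r0.
by apply: sumr_ge0 => k _; apply: sumr_ge0 => l _; apply: r0.
Qed.

(** For t in [0,1], a^t <= max 1 a <= 1 + a. *)
Lemma mxpowR_entry_le A : psdmx A ->
  exists c, forall t : R, 0 <= t <= 1 -> entry_le (mxpowR A t) c.
Proof.
move=> /psd_eigdec [U [a [ha a0]]].
pose c := 1 + \sum_i a i.
exists (n%:R * ((n%:R * (1 * c)) * 1)) => t t01.
rewrite /mxpowR (mxcalcE _ ha).
have hU : U \is unitarymx by case: ha.
apply: entry_le_mul (entry_le_unitary hU).
apply: entry_le_mul; first exact/entry_le_adj/entry_le_unitary.
apply: entry_le_rdiag => i; rewrite /= powR_ge0 /=.
have ai : a i <= \sum_i a i by rewrite (bigD1 i) //= lerDl sumr_ge0.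
have [a1|a1] := leP (a i) 1; last first.
  apply: (@le_trans _ _ (a i)); last by rewrite /c; lra.
  by apply: ler1_powR; lra.
apply: (@le_trans _ _ 1); last by rewrite /c; have := a0 i; lra.
have := @ge0_ler_powR _ t ltac:(lra) (a i) 1; rewrite !nnegrE powR1.
by apply.
Qed.
End Powers.

(** * Unitarily invariant norms *)

Section Gauge.
Variables (R : realType) (n : nat) (N : 'M[R[i]]_n -> R).
Hypotheses (hN : mxnorm N) (hNU : unitarily_invariant N).

Lemma norm_realZ (c : R) T : 0 <= c -> N (c%:C *: T) = c * N T.
Proof. by move=> c0; rewrite (mxnormZ hN) ger0_norm // ler0c. Qed.

Lemma norm_mul_unitary (V M : 'M[R[i]]_n) : V \is unitarymx ->
  N (V *m M) = N M.
Proof.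
move=> hV; have h1 : (1%:M : 'M[R[i]]_n) \is unitarymx.
  by apply/unitarymxP; rewrite mul1mx tr_scalar_mx map_mx1.
by rewrite -(hNU M hV h1) mulmx1.
Qed.

Lemma norm_avg_unitary (V M : 'M[R[i]]_n) : V \is unitarymx ->
  N ((2^-1)%:C *: (V *m M + V^t* *m M)) <= N M.
Proof.
move=> hV; have hVt : V^t* \is unitarymx by rewrite trmxC_unitary.
have := mxnormD hN (V *m M) (V^t* *m M).
rewrite (norm_mul_unitary _ hV) (norm_mul_unitary _ hVt) norm_realZ; lra.
Qed.

(** Write x_i = y_i cos th_i. Then diag x is the average of W diag y and
    W^* diag y, where W is the unitary diagonal matrix with entries e^(i th_i). *)
Lemma norm_rdiag_mono (x y : 'I_n -> R) : (forall i, 0 <= x i <= y i) ->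
  N (rdiag x) <= N (rdiag y).
Proof.
move=> h.
pose c i := x i / y i.
have cy i : x i = c i * y i.
  rewrite /c; have [y0|y0] := eqVneq (y i) 0; last by rewrite divfK.
  by have := h i; rewrite y0 mulr0 => /andP [x0 x1]; apply: le_anti; rewrite x0 x1.
have c1 i : 0 <= 1 - c i ^+ 2.
  have /andP [x0 xy] := h i; rewrite subr_ge0 expr_le1 //.
    rewrite /c; have [y0|y0] := eqVneq (y i) 0; first by rewrite y0 invr0 mulr0.
    by rewrite ler_pdivrMr ?mul1r // lt_def y0 (le_trans x0).
  by rewrite divr_ge0 // (le_trans x0).
pose w i : R[i] := c i +i* Num.sqrt (1 - c i ^+ 2).
have w1 i : w i * (w i)^*%R = 1.
  rewrite -normCK normc_def /= sqr_sqrtr // addrCA subrr addr0 sqrtr1.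
  by rewrite expr1n.
have wD i : w i + (w i)^*%R = (2 * c i)%:C.
  by have -> : (w i)^*%R = ((w i)^*)%C by []; rewrite addcJ !mulr_natl rmorphMn.
pose W : 'M[R[i]]_n := diag_mx (\row_i w i).
have hW : W \is unitarymx.
  apply/unitarymxP; rewrite tr_diag_mx map_diag_mx; apply/matrixP => i j.
  rewrite mul_diag_mx !mxE; case: eqP => [->|_]; last by rewrite !mulr0n mulr0.
  by rewrite !mulr1n w1.
suff -> : rdiag x = (2^-1)%:C *: (W *m rdiag y + W^t* *m rdiag y).
  exact: norm_avg_unitary.
rewrite tr_diag_mx map_diag_mx -mulmxDl; apply/matrixP => i j.
rewrite -[diag_mx _ + _]raddfD /= mxE mul_diag_mx !mxE wD.
case: eqP => [_|_]; rewrite ?mulr0n ?mulr0 // !mulr1n -!rmorphM cy.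
by congr (_%:C); field.
Qed.

(** Permuting the coordinates of x conjugates diag x by a permutation matrix. *)
Lemma norm_rdiag_perm_comb (q : R) (x : 'I_n -> R) (s : 'S_n) : 0 <= q <= 1 ->
  N (rdiag (fun i => (1 - q) * x i + q * x (s i))) <= N (rdiag x).
Proof.
move=> q01.
have -> : rdiag (fun i => (1 - q) * x i + q * x (s i)) =
    (1 - q)%:C *: rdiag x + q%:C *: rdiag (x \o s).
  apply/matrixP => i j; rewrite !mxE.
  by case: eqP => _; rewrite ?mulr0n ?mulr0 ?addr0 // !mulr1n rmorphD !rmorphM.
apply: le_trans (mxnormD hN _ _) _; rewrite !norm_realZ; try lra.
have hP := @perm_mx_unitary R n s.
have hPt : (perm_mx s)^t* \is @unitarymx R[i] n n by rewrite trmxC_unitary.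
rewrite rdiag_perm (hNU _ hP hPt); lra.
Qed.

(** For every c > 0, sqrt (y_i z_i) <= (c y_i + z_i / c) / 2. *)
Lemma norm_rdiag_cauchy (y z : 'I_n -> R) :
  (forall i, 0 <= y i) -> (forall i, 0 <= z i) ->
  N (rdiag (fun i => Num.sqrt (y i * z i))) ^+ 2 <= N (rdiag y) * N (rdiag z).
Proof.
move=> y0 z0; apply: sqr_le_of_amgm; rewrite ?(mxnorm_ge0 hN) // => c c0.
have ci0 : 0 <= c^-1 by rewrite invr_ge0 ltW.
rewrite -!norm_realZ ?(ltW c0) //.
have := mxnormD hN (c%:C *: rdiag y) (c^-1%:C *: rdiag z).
apply: le_trans.
have -> : c%:C *: rdiag y + c^-1%:C *: rdiag z
    = 2%:C *: rdiag (fun i => (c * y i + c^-1 * z i) / 2).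
  apply/matrixP => i j; rewrite !mxE.
  case: eqP => _; rewrite ?mulr0n ?mulr0 ?addr0 // !mulr1n -!rmorphM -rmorphD.
  by congr (_%:C); field; rewrite gt_eqF.
rewrite !norm_realZ // ler_pM2l //; apply: norm_rdiag_mono => i.
rewrite sqrtr_ge0 /=.
have cy : 0 <= c * y i by rewrite mulr_ge0 // ltW.
have cz : 0 <= c^-1 * z i by rewrite mulr_ge0.
have -> : y i * z i = (c * y i) * (c^-1 * z i).
  by field; rewrite gt_eqF.
rewrite -ler_sqr ?nnegrE ?sqrtr_ge0 //; last by lra.
rewrite sqr_sqrtr; last exact: mulr_ge0.
have := sqr_ge0 (c * y i - c^-1 * z i).
move: (c * y i) (c^-1 * z i) => a b; lra.
Qed.

Lemma norm_conj_unitary (P M : 'M[R[i]]_n) : P \is unitarymx ->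
  N (P^t* *m M *m P) = N M.
Proof.
move=> hP; have hPt : P^t* \is unitarymx by rewrite trmxC_unitary.
exact: hNU hPt hP.
Qed.

Definition norm_abs_pow (r : R) (T : 'M[R[i]]_n) := N (mxpowR (absmx T) r).

Lemma norm_abs_powE r T P t : eigdec (T^t* *m T) P t ->
  norm_abs_pow r T = N (rdiag (fun i => powR (t i) (1 / 2 * r))).
Proof.
move=> ht; have [hP _] := ht.
rewrite /norm_abs_pow /mxpowR (mxcalcE _ (eigdec_calc _ ht)) (norm_conj_unitary _ hP).
by congr (N _); apply: eq_rdiag => i; rewrite /= [RHS]powRrM.
Qed.

Lemma powR_prod (t : 'I_n -> R) (k : pred 'I_n) (e : R) : (forall i, 0 <= t i) ->
  \prod_(i < n | k i) powR (t i) e = powR (\prod_(i < n | k i) t i) e.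
Proof.
move=> t0; suff [_ ->] : 0 <= \prod_(i < n | k i) t i /\
  \prod_(i < n | k i) powR (t i) e = powR (\prod_(i < n | k i) t i) e by [].
apply: (big_rec2 (fun a b => 0 <= b /\ a = powR b e)).
  by rewrite powR1.
by move=> i a b _ [b0 ->]; rewrite powRM //; split=> //; apply: mulr_ge0.
Qed.

(** The prefix products of the eigenvalues raised to the power r/2 obey
    [log_majorization]; comparing with the geometric means of the eigenvalues
    on the right reduces the claim to [norm_rdiag_cauchy]. *)
Lemma norm_abs_pow_cauchy r (G D Y : 'M[R[i]]_n) :
  0 <= r -> G^t* = G -> D^t* = D ->
  norm_abs_pow r (G *m Y *m D) ^+ 2 <=
    norm_abs_pow r (G *m G *m Y) * norm_abs_pow r (Y *m D *m D).
Proof.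
move=> r0 hG hD.
have [P [t [ht st]]] := eigdec_sorted (gram_herm (G *m Y *m D)).
have [U1 [q [hq sq]]] := eigdec_sorted (gram_herm (G *m G *m Y)).
have [U2 [l [hl sl]]] := eigdec_sorted (gram_herm (Y *m D *m D)).
have lm := log_majorization hG hD ht st hq sq hl sl.
rewrite (norm_abs_powE _ ht) (norm_abs_powE _ hq) (norm_abs_powE _ hl).
have t0 := eigdec_gram_ge0 ht; have q0 := eigdec_gram_ge0 hq.
have l0 := eigdec_gram_ge0 hl.
set e := 1 / 2 * r; have e0 : 0 <= e by rewrite /e; lra.
pose y i := powR (q i) e; pose z i := powR (l i) e.
apply: le_trans (norm_rdiag_cauchy (y := y) (z := z) _ _); last 2 first.
- by move=> i; apply: powR_ge0.
- by move=> i; apply: powR_ge0.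
rewrite ler_sqr ?nnegrE ?(mxnorm_ge0 hN) //.
apply: (@weak_major_gauge R n (fun x => N (rdiag x))).
- exact: norm_rdiag_mono.
- exact: norm_rdiag_perm_comb.
- by move=> i; apply: sqrtr_ge0.
- by move=> i; apply: powR_ge0.
- by move=> i j ij; apply: ge0_ler_powR => //; rewrite ?nnegrE // st.
apply: weak_log_major_ord.
- by move=> i; apply: sqrtr_ge0.
- by move=> i; apply: powR_ge0.
- by move=> i j ij; apply: ge0_ler_powR => //; rewrite ?nnegrE // st.
move=> k kn.
rewrite -ler_sqr ?nnegrE; last 2 first.
- by apply: prodr_ge0 => i _; apply: powR_ge0.
- by apply: prodr_ge0 => i _; apply: sqrtr_ge0.
have -> : (\prod_(i < n | (i < k)%N) Num.sqrt (y i * z i)) ^+ 2 =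
    (\prod_(i < n | (i < k)%N) y i) * (\prod_(i < n | (i < k)%N) z i).
  rewrite -big_split -prodrXl; apply: eq_bigr => i _.
  by rewrite sqr_sqrtr // mulr_ge0 // powR_ge0.
have p0 (d : 'I_n -> R) : (forall i, 0 <= d i) ->
    0 <= \prod_(i < n | (i < k)%N) d i by move=> h; apply: prodr_ge0.
rewrite /y /z !powR_prod // -powRM ?p0 // expr2 -powRM ?p0 // -expr2.
apply: ge0_ler_powR => //; last exact: lm.
  by rewrite nnegrE sqr_ge0.
by rewrite nnegrE mulr_ge0 // p0.
Qed.

(** [norm_abs_pow_cauchy] for Y = Gs X Dt. The products are variables here so
    that reassociating them cannot unfold the matrix powers they stand for. *)
Lemma norm_abs_pow_midpoint (X G D Gs Gm Gt Ds Dm Dt : 'M[R[i]]_n) r : 0 <= r ->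
  G^t* = G -> D^t* = D ->
  G *m Gs = Gm -> G *m Gm = Gt -> Dt *m D = Dm -> Dm *m D = Ds ->
  norm_abs_pow r (Gm *m X *m Dm) ^+ 2 <=
    norm_abs_pow r (Gt *m X *m Dt) * norm_abs_pow r (Gs *m X *m Ds).
Proof.
move=> r0 hG hD <- <- <- <-.
by have := norm_abs_pow_cauchy (Gs *m X *m Dt) r0 hG hD; rewrite !mulmxA.
Qed.
End Gauge.

(** * The interpolating family *)

Section Interpolation.
Variables (R : realType) (n : nat) (N : 'M[R[i]]_n -> R).
Hypotheses (hN : mxnorm N) (hNU : unitarily_invariant N).
Variables (A B X : 'M[R[i]]_n) (r : R).
Hypotheses (hA : psdmx A) (hB : psdmx B) (hr : 0 <= r).

Definition interp_norm (t : R) :=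
  norm_abs_pow N r (mxpowR A t *m X *m mxpowR B (1 - t)).

Lemma interp_norm_ge0 t : 0 <= interp_norm t.
Proof. exact: mxnorm_ge0 hN _. Qed.

(** With d = (t - s)/2, multiplying by A^d on the left and B^d on the right
    shifts the exponents of A^s X B^(1-t) to the midpoint, and multiplying twice
    on one side only shifts them to t or to s. *)
Lemma interp_norm_midpoint s t : 0 <= s <= 1 -> 0 <= t <= 1 ->
  interp_norm ((s + t) / 2) ^+ 2 <= interp_norm s * interp_norm t.
Proof.
wlog st : s t / s <= t => [H hs ht|hs ht].
  have [st|ts] := leP s t; first exact: H.
  by rewrite addrC [interp_norm s * _]mulrC; apply: H => //; apply: ltW.
pose d := (t - s) / 2.
have d0 : 0 <= d by rewrite /d; lra.
have t1 : 0 <= 1 - t by lra.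
have s0 : 0 <= s by lra.
have m0 : 0 <= (s + t) / 2 by lra.
have m1 : 0 <= 1 - (s + t) / 2 by lra.
have addA a b c : a + b = c -> 0 <= a -> 0 <= b ->
    mxpowR A a *m mxpowR A b = mxpowR A c.
  by move=> <-; apply: mxpowR_mul.
have addB a b c : a + b = c -> 0 <= a -> 0 <= b ->
    mxpowR B a *m mxpowR B b = mxpowR B c.
  by move=> <-; apply: mxpowR_mul.
rewrite [interp_norm s * _]mulrC.
apply: (norm_abs_pow_midpoint hN hNU X hr (mxpowR_herm d hA) (mxpowR_herm d hB)).
- by apply: addA => //; rewrite /d; field.
- by apply: addA => //; rewrite /d; field.
- by apply: addB => //; rewrite /d; field.
- by apply: addB => //; rewrite /d; field.
Qed.

(** The eigenvalues of T^* T are diagonal entries of P (T^* T) P^*, for a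
    unitary P depending on t, and the entries of such a product are bounded
    uniformly in t. *)
Lemma interp_norm_bounded : exists M,
  forall t : R, 0 <= t <= 1 -> interp_norm t <= M.
Proof.
have [cA hcA] := mxpowR_entry_le hA; have [cB hcB] := mxpowR_entry_le hB.
have [cX hcX] := entry_le_ex X.
pose mc (c1 c2 : R) := n%:R * (c1 * c2).
pose c := mc (mc cA cX) cB.
pose K := mc (mc 1 (mc c c)) 1.
exists (N (rdiag (fun=> powR K (1 / 2 * r)))) => t t01.
rewrite /interp_norm; set T := _ *m X *m _.
have hT : entry_le T c.
  apply: entry_le_mul; last by apply: hcB; lra.
  by apply: entry_le_mul; first exact: hcA.
have [P [d hd]] := eigdec_ex (gram_herm T).
have d0 := eigdec_gram_ge0 hd.
rewrite (norm_abs_powE hNU _ hd); apply: norm_rdiag_mono => // i.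
rewrite powR_ge0 /=.
have hdK : d i <= K.
  have [hP e] := hd.
  have : entry_le (P *m (T^t* *m T) *m P^t*) K.
    apply: entry_le_mul; last exact/entry_le_adj/entry_le_unitary.
    apply: entry_le_mul; first exact: entry_le_unitary.
    by apply: entry_le_mul; first exact: entry_le_adj.
  move=> /(_ i i); rewrite e !mulmxA (unitarymxP hP) mul1mx.
  rewrite (mulmxtVK _ hP) !mxE eqxx mulr1n ger0_norm ?ler0c //.
  by rewrite lecR.
have e0 : 0 <= 1 / 2 * r by apply: mulr_ge0 => //; apply: divr_ge0.
apply: (ge0_ler_powR e0) => //; rewrite nnegrE //.
exact: le_trans hdK.
Qed.

(** The second factor is interp_norm (1 - t), with the exponents t and 1 - t
    written as they occur in the main statement. *)
Definition interp_prod (t : R) :=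
  interp_norm t
  * norm_abs_pow N r (mxpowR A (1 - t) *m X *m mxpowR B t).

Lemma interp_prodE t : interp_prod t = interp_norm t * interp_norm (1 - t).
Proof. by rewrite /interp_prod /interp_norm subKr. Qed.

Lemma interp_prod_sym t : interp_prod (1 - t) = interp_prod t.
Proof. by rewrite !interp_prodE subKr; exact: mulrC. Qed.

Lemma interp_prod_convex : convex01 interp_prod.
Proof.
have [M hM] := interp_norm_bounded.
have flip (t : R) : 0 <= t <= 1 -> 0 <= 1 - t <= 1 by lra.
have f0 u : 0 <= interp_prod u.
  by rewrite interp_prodE mulr_ge0 ?interp_norm_ge0.
apply: (@convex_of_midpoint R _ (M * M)) => [t ht|s t hs ht].
  rewrite f0 interp_prodE /=.
  by rewrite ler_pM ?interp_norm_ge0 // hM // flip.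
have h1 := interp_norm_midpoint hs ht.
have h2 := interp_norm_midpoint (flip _ hs) (flip _ ht).
have e : (1 - s + (1 - t)) / 2 = 1 - (s + t) / 2 by field.
rewrite e in h2.
apply: le_mean_of_sqr (f0 _) (f0 _) (f0 _) _.
rewrite !interp_prodE exprMn.
apply: le_trans (ler_pM (sqr_ge0 _) (sqr_ge0 _) h1 h2) _.
move: (interp_norm s) (interp_norm t).
by move: (interp_norm (1 - s)) (interp_norm (1 - t)) => a b c d; rewrite mulrACA.
Qed.
End Interpolation.

Theorem theorem3p2 (R : realType) (n : nat) (A B X : 'M[R[i]]_n)
    (N : 'M[R[i]]_n -> R) (r mu p : R)
    (hA : psdmx A) (hB : psdmx B) (hr : 0 <= r) (hmu : 0 <= mu <= 1)
    (hp : 0 < p < 1) (hN : mxnorm N) (hNU : unitarily_invariant N) :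
  let f (t : R) :=
    N (mxpowR (absmx (mxpowR A t *m X *m mxpowR B (1 - t))) r) *
    N (mxpowR (absmx (mxpowR A (1 - t) *m X *m mxpowR B t)) r) in
  N (mxpowR (absmx (A *m X)) r) * N (mxpowR (absmx (X *m B)) r)
    - N (mxpowR (absmx (mxpowR A mu *m X *m mxpowR B (1 - mu))) r)
      * N (mxpowR (absmx (mxpowR A (1 - mu) *m X *m mxpowR B mu)) r)
    >= 1 / p * (f ((1 - p) / 2) - f ((1 - p) / 2 + p * mu))
  /\ 1 / p * (f ((1 - p) / 2) - f ((1 - p) / 2 + p * mu)) >= 0.
Proof.
move=> f.
have cf : convex01 f := interp_prod_convex hN hNU X hA hB hr.
have sf t : f (1 - t) = f t := interp_prod_sym N A B X r t.
have := symmetric_convex_slopes cf sf hmu hp.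
have -> : f 0 = N (mxpowR (absmx (A *m X)) r) * N (mxpowR (absmx (X *m B)) r).
  rewrite /f subr0 (mxpowR0 hA) (mxpowR0 hB) (mxpowR1 hA) (mxpowR1 hB).
  by rewrite mul1mx mulmx1; exact: mulrC.
exact: id.
Qed.
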